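(* Let $G$ be a finite group, $H$ a subgroup of $G$, and $Z := H \backslash G / H$. Let $\epsilon$ be a real number. Suppose there is an anti-involution $\sigma$ on $G$ which induces a (well-defined) linear map $\sigma : \mathbb{C}[Z] \to \mathbb{C}[Z]$ via $HgH \mapsto H\sigma(g)H$, such that the subspace $\mathbb{C}[Z]^\sigma$ of $\sigma$-fixed vectors satisfies $\mathrm{codim}\, \mathbb{C}[Z]^\sigma \leq \epsilon \dim \mathbb{C}[Z]$. Then \[ \frac{\left|\{\rho \in \mathrm{Irr}(G) \mid \dim\mathrm{Hom}_G(\rho, \mathbb{C}[G/H]) = 1\}\right|}{\left|\{\rho \in \mathrm{Irr}(G) \mid \dim\mathrm{Hom}_G(\rho, \mathbb{C}[G/H]) > 0\}\right|} \geq 1 - 4\epsilon. \]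
   Context: An anti-involution on $G$ is a map $\sigma : G \to G$ with $\sigma(gh) = \sigma(h)\sigma(g)$ and $\sigma^2 = 1$. $\mathrm{Irr}(G)$ is the set of isomorphism classes of irreducible complex representations of $G$, $\mathbb{C}[G/H]$ is the permutation representation of $G$ on $G/H$, and $\mathbb{C}[Z]$ is the complex vector space with basis the double cosets (equivalently, the space of $(H,H)$-invariant functions on $G$). *)

(* Defs.v *)
From mathcomp Require Import all_boot all_order all_algebra all_fingroup.
From mathcomp Require Import all_character.
From mathcomp Require Import complex reals.

Set Implicit Arguments.
Unset Strict Implicit.
Unset Printing Implicit Defensive.

Import GroupScope GRing.Theory.
Local Open Scope ring_scope.

Section Representations.

Variables (F : fieldType) (gT : finGroupType) (G : {group gT}).

(* A matrix representation rG is read as the left action v |-> rG g *m v on    *)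
(* column vectors, so that an intertwiner X from rG to sG satisfies            *)
(* X *m rG g = sG g *m X.                                                      *)
Definition homG n m (rG : mx_representation F G n)
    (sG : mx_representation F G m) : {vspace 'M[F]_(m, n)} :=
  (\bigcap_(g in G) lker (linfun (mulmxr (rG g) \- mulmx (sG g))))%VS.

Lemma homGP n m (rG : mx_representation F G n) (sG : mx_representation F G m)
    (X : 'M[F]_(m, n)) :
  reflect {in G, forall g, X *m rG g = sG g *m X} (X \in homG rG sG).
Proof.
apply: (iffP idP) => [XG g Gg | XG].
  have /subv_bigcapP/(_ g Gg) : (<[X]> <= homG rG sG)%VS by rewrite -memvE.
  by rewrite -memvE memv_ker lfunE /= subr_eq0 => /eqP.
rewrite memvE; apply/subv_bigcapP => g Gg; rewrite -memvE.
by rewrite memv_ker lfunE /= subr_eq0 XG.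
Qed.

Variable H : {group gT}.

(* F[G/H]: the basis is indexed by the left cosets xH, on which g acts by left *)
(* multiplication; column j of the matrix of g is the image of the j-th coset. *)
Definition lcosets_mx (g : gT) : 'M[F]_#|lcosets H G| :=
  \matrix_(i, j) ((enum_val i : {set gT}) == (g *: enum_val j)%g)%:R.

Lemma lcosets_mx_repr : mx_repr G lcosets_mx.
Proof.
split=> [|g h Gg Gh]; apply/matrixP => i j; rewrite !mxE.
  by rewrite mul1g (inj_eq enum_val_inj).
have Hhj : (h *: enum_val j)%g \in lcosets H G.
  have /imsetP[x Gx ->] := enum_valP j; apply/imsetP.
  by exists (h * x)%g; rewrite ?groupM // !lcosetE lcosetM.
rewrite (bigD1 (enum_rank_in Hhj (h *: enum_val j)%g)) //= !mxE.
rewrite enum_rankK_in // eqxx mulr1 lcosetM big1 ?addr0 // => k nk.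
rewrite !mxE -(enum_rankK_in Hhj Hhj) (inj_eq enum_val_inj) (negPf nk).
by rewrite mulr0.
Qed.

Definition lcosets_repr : mx_representation F G #|lcosets H G| :=
  MxRepresentation lcosets_mx_repr.

End Representations.

(* Irr indexes the isomorphism classes of simple submodules of the regular     *)
(* representation; in characteristic 0, by Maschke's theorem, these are all the *)
(* isomorphism classes of irreducible representations.                         *)
Definition Irr (F : decFieldType) (gT : finGroupType) (G : {group gT}) :
  irrType F G := DecSocleType (regular_repr F G).

Section DoubleCosets.

Variables (F : fieldType) (gT : finGroupType) (G H : {group gT}).

Definition dcosets : {set {set gT}} := [set (H :* g * H)%g | g in G].

Definition dcoset_space := {ffun {D : {set gT} | D \in dcosets} -> F^o}.

(* For g in G, the element of the standard basis of F[H\G/H] attached to HgH. *)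
Definition dcoset_vec (g : gT) : dcoset_space :=
  [ffun D => (val D == (H :* g * H)%g)%:R].

End DoubleCosets.

(* The conditions bear only on the restriction of s to G. *)
Definition anti_involution (gT : finGroupType) (G : {group gT})
    (s : gT -> gT) : Prop :=
  [/\ {in G, forall g, s g \in G},
      {in G &, forall g h, s (g * h)%g = (s h * s g)%g}
    & {in G, forall g, s (s g) = g}].

(* Main.v *)
(** Let V = C[G/H] and m_i = dim Hom_G(rho_i, V).  The anti-involution turns a
    sigma-fixed function f on H\G/H into the symmetric bilinear form
    (xH, yH) |-> f(H sigma(y) x H) on V, which intertwines V with its
    sigma-dual, g |-> V(sigma g)^T.  Restricted to a pair of irreducible
    summands of V such a form lives in a space of dimension at most 1, and
    symmetry makes the pairs a <= b suffice, so that
      2 dim C[Z]^sigma <= sum_i m_i^2 + sum_i m_i.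
    Since dim C[Z] >= sum_i m_i^2, a small codimension of C[Z]^sigma forces
    sum_i (m_i^2 - m_i) to be small compared with sum_i m_i^2, and the i with
    m_i >= 2 are the only ones contributing to the former. *)

From HB Require Import structures.
Require Import Defs.
From mathcomp Require Import all_boot all_order all_algebra all_fingroup.
From mathcomp Require Import all_solvable all_character.
From mathcomp Require Import complex reals lra.

Set Implicit Arguments.
Unset Strict Implicit.
Unset Printing Implicit Defensive.

Import Order.TTheory GroupScope GRing.Theory Num.Theory.
Local Open Scope ring_scope.

(** * Intertwiners between irreducible representations: Schur's lemma and averaging *)

Lemma linear_lfun (K : fieldType) (aT rT : vectType K) (f : aT -> rT) :
  linear f -> exists fL : 'Hom(aT, rT), fL =1 f.
Proof.
move=> lin_f; pose fM := GRing.isLinear.Build K aT rT *:%R f lin_f.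
pose fL : {linear aT -> rT} := HB.pack f fM.
by exists (linfun fL) => u; rewrite lfunE.
Qed.

(** The row space of [X] is a nonzero submodule for [rG], hence everything. For the action on column
    vectors this is injectivity of [X]. *)
Lemma homG_row_full (F : fieldType) (gT : finGroupType) (G : {group gT}) n m
    (rG : mx_representation F G n) (sG : mx_representation F G m) X :
  mx_irreducible rG -> X \in homG rG sG -> X != 0 -> row_full X.
Proof.
move=> /mx_irrP[_ irr_r] /homGP XG nzX.
have modX : mxmodule rG <<X>>%MS.
  apply/mxmoduleP=> g Gg; rewrite genmxE.
  by rewrite (eqmxMr _ (genmxE X)) XG // submxMl.
by have := irr_r _ modX; rewrite -mxrank_eq0 /row_full genmxE mxrank_eq0; apply.
Qed.

(** Dually, the left kernel of [X] is a submodule for [sG], and it is proper because [X] is nonzero.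
    This is surjectivity on column vectors. *)
Lemma homG_row_free (F : fieldType) (gT : finGroupType) (G : {group gT}) n m
    (rG : mx_representation F G n) (sG : mx_representation F G m) X :
  mx_irreducible sG -> X \in homG rG sG -> X != 0 -> row_free X.
Proof.
move=> /mx_irrP[_ irr_s] /homGP XG; apply: contraNT; rewrite -kermx_eq0 => nzK.
have modK : mxmodule sG (kermx X).
  apply/mxmoduleP=> g Gg; apply/sub_kermxP.
  by rewrite -mulmxA -XG // mulmxA mulmx_ker mul0mx.
have /row_fullP[B BK] := irr_s _ modK nzK.
by rewrite -[X]mul1mx -BK -mulmxA mulmx_ker mulmx0.
Qed.

Lemma homG_rsim (F : fieldType) (gT : finGroupType) (G : {group gT}) n m
    (rG : mx_representation F G n) (sG : mx_representation F G m) X :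
  mx_irreducible rG -> mx_irreducible sG -> X \in homG rG sG -> X != 0 ->
  mx_rsim sG rG.
Proof.
move=> irr_r irr_s XG nzX.
have freeX := homG_row_free irr_s XG nzX.
have fullX := homG_row_full irr_r XG nzX.
apply: (@MxReprSim _ _ _ _ _ _ _ X) => // [|g Gg].
  by rewrite -(eqP freeX) (eqP fullX).
by rewrite (homGP _ _ _ XG).
Qed.

Lemma homG_scalar (F : fieldType) (gT : finGroupType) (G : {group gT}) n
    (rG : mx_representation F G n) X :
  mx_absolutely_irreducible rG -> X \in homG rG rG -> is_scalar_mx X.
Proof.
move=> absr /homGP XG; apply: (mx_abs_irr_cent_scalar absr).
by apply/centgmxP => g Gg; rewrite XG.
Qed.

Lemma homG_comp (F : fieldType) (gT : finGroupType) (G : {group gT}) n m p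
    (rG : mx_representation F G n) (sG : mx_representation F G m)
    (tG : mx_representation F G p) X Y :
  X \in homG sG tG -> Y \in homG rG sG -> X *m Y \in homG rG tG.
Proof.
move=> /homGP XG /homGP YG; apply/homGP => g Gg.
by rewrite -mulmxA YG // !mulmxA XG.
Qed.

(** Maschke's argument: [X] has a left inverse as a matrix, and averaging it over [G] makes it
    equivariant while each summand still inverts [X]. *)
Lemma homG_left_inverse (F : fieldType) (gT : finGroupType) (G : {group gT})
    n m (rG : mx_representation F G n) (sG : mx_representation F G m) X :
  [pchar F]^'.-group G -> mx_irreducible rG -> X \in homG rG sG -> X != 0 ->
  exists2 Y, Y \in homG sG rG & Y *m X = 1%:M.
Proof.
move=> F'G irr_r XG nzX.
have /row_fullP[Y YX] := homG_row_full irr_r XG nzX.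
have nzG : #|G|%:R != 0 :> F.
  by rewrite -pcharf'_nat.
exists (#|G|%:R^-1 *: \sum_(g in G) rG g^-1%g *m Y *m sG g).
  apply/homGP => g Gg; rewrite -scalemxAl -scalemxAr; congr (_ *: _).
  rewrite mulmx_suml mulmx_sumr.
  rewrite (reindex_inj (mulIg (g^-1)%g)) /=.
  rewrite (eq_bigl [in G]) => [|h]; last by rewrite groupMr ?groupV.
  apply: eq_bigr => h Gh; rewrite invMg invgK -!mulmxA -repr_mxM ?groupM ?groupV //.
  by rewrite mulgKV repr_mxM ?groupV // !mulmxA.
rewrite -scalemxAl mulmx_suml.
rewrite (eq_bigr (fun _ => 1%:M)) => [|g Gg].
  by rewrite sumr_const -scaler_nat scalerA mulVf ?scale1r.
rewrite -!mulmxA -((homGP _ _ _ XG) _ Gg) (mulmxA Y) YX mul1mx -repr_mxM ?groupV //.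
by rewrite mulVg repr_mx1.
Qed.

(** * Multiplicity spaces and the endomorphism algebra of a representation *)

Section Multiplicities.

Variables (F : closedFieldType) (gT : finGroupType) (G : {group gT}).
Hypothesis F'G : [pchar F]^'.-group G.
Variables (n : nat) (rG : mx_representation F G n).
Let sG := Irr F G.

Lemma irr_repr_abs (i : sG) : mx_absolutely_irreducible (irr_repr i).
Proof. exact/group_closure_closed_field/socle_irr. Qed.

Lemma homG_irr_eq (i j : sG) X :
  X \in homG (irr_repr i) (irr_repr j) -> X != 0 -> i = j.
Proof.
move=> XG nzX; apply/esym.
have := irr_comp_rsim_pchar sG F'G (homG_rsim (socle_irr i) (socle_irr j) XG nzX).
by rewrite !irr_reprK_pchar.
Qed.

(* A vector killed by all these X spans a submodule killed by them; project V  *)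
(* onto a simple submodule of it.                                              *)
Lemma homG_irr_separate m (v : 'M_(m, n)) :
  (forall (i : sG) X, X \in homG (irr_repr i) rG -> v *m X = 0) -> v = 0.
Proof.
move=> vX; apply/row_matrixP => k; rewrite row0; apply/eqP/idPn.
move=> nzu; set u := row k v in nzu.
have [|U simU sUc] := dec_mxsimple_exists (cyclic_mx_module rG u).
  by rewrite cyclic_mx_eq0.
have UX0 (i : sG) X : X \in homG (irr_repr i) rG -> U *m X = 0.
  move=> XG; apply/sub_kermxP; apply: submx_trans sUc _; apply: cyclic_mx_sub.
    apply/mxmoduleP=> g Gg; apply/sub_kermxP.
    by rewrite -mulmxA -(homGP _ _ _ XG) // mulmxA mulmx_ker mul0mx.
  by apply/sub_kermxP; rewrite /u -row_mul (vX i) // row0.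
have [modU nzU _] := simU.
have [W modW sumUW dxUW] := mx_Maschke_pchar rG F'G modU (submx1 U).
have irrU := (submod_mx_irr modU).2 simU.
have [B _ freeB homB] := rsim_irr_comp_pchar sG F'G irrU.
have tiUW := mxdirect_addsP dxUW.
have homP g : g \in G -> rG g *m proj_mx U W = proj_mx U W *m rG g.
  move=> Gg; have := hom_mxP (proj_mx_hom tiUW modU modW) g Gg.
  have /row_fullP[C CUW] : row_full (U + W)%MS by rewrite -sub1mx sumUW.
  by move/(congr1 (mulmx C)); rewrite !mulmxA CUW !mul1mx.
(* On row vectors, this intertwiner projects onto [U] along [W] and then identifies [U] with its
   irreducible type. The projection is the identity on [U] and [B] is injective, so it cannot kill
   [U]. *)
have XG : in_submod U (proj_mx U W) *m B
    \in homG (irr_repr (irr_comp sG (submod_repr modU))) rG.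
  apply/homGP => g Gg; rewrite -mulmxA -homB // mulmxA /=.
  rewrite -in_submodJ ?proj_mx_sub //; last first.
    by rewrite -[proj_mx U W]mul1mx proj_mx_sub.
  by rewrite -homP // in_submodE [in RHS]in_submodE !mulmxA.
move/eqP: (UX0 _ _ XG).
rewrite mulmxA mulmx_free_eq0 // in_submodE mulmxA proj_mx_id //.
rewrite -in_submodE => /eqP U0.
by move: nzU; rewrite -(in_submodK (submx_refl U)) U0 linear0 eqxx.
Qed.


(** By Schur's lemma, composing an element of [J] with one of [I] gives a scalar, so composition is
    a bilinear pairing with Gram matrix [Q]. A left inverse of [Q] combines the basis of [J] into a
    family dual to the basis of [I]. *)
Lemma homG_dual_basis (i : sG) (I := homG (irr_repr i) rG) :
  exists2 pi : 'I_(\dim I) -> 'M_(irr_degree i, n),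
    forall k, pi k \in homG rG (irr_repr i)
  & forall k l : 'I_(\dim I), pi k *m (vbasis I)`_l = (k == l)%:R%:M.
Proof.
set J := homG rG (irr_repr i).
have basI (l : 'I_(\dim I)) : (vbasis I)`_l \in I.
  by apply/vbasis_mem/mem_nth; rewrite size_tuple.
have basJ (k : 'I_(\dim J)) : (vbasis J)`_k \in J.
  by apply/vbasis_mem/mem_nth; rewrite size_tuple.
have [Q QE] : exists Q : 'M_(\dim J, \dim I),
    forall (k : 'I_(\dim J)) (l : 'I_(\dim I)),
      (vbasis J)`_k *m (vbasis I)`_l = (Q k l)%:M.
  have /fin_all_exists[q qE] (kl : 'I_(\dim J) * 'I_(\dim I)) :
      exists a, (vbasis J)`_kl.1 *m (vbasis I)`_kl.2 = a%:M.
    apply/is_scalar_mxP/homG_scalar/(homG_comp (basJ _) (basI _)).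
    exact: irr_repr_abs.
  by exists (\matrix_(k, l) q (k, l)) => k l; rewrite mxE -qE.
(* A kernel vector of Q is an X in I killed by all of J, so X = 0 since X has  *)
(* an equivariant left inverse unless X = 0.                                   *)
have fullQ : row_full Q.
  rewrite /row_full -mxrank_tr -[_ == _]/(row_free Q^T) -kermx_eq0.
  apply/eqP/row_matrixP => r; rewrite row0; set c := row r _.
  have Qc k : \sum_l c 0 l * Q k l = 0.
    have : (c *m Q^T) 0 k = 0 by rewrite -row_mul mulmx_ker row0 mxE.
    rewrite mxE; apply: etrans; apply: eq_bigr => l _.
    by rewrite [Q^T _ _]mxE.
  have X0 : \sum_l c 0 l *: (vbasis I)`_l = 0.
    set X := \sum_l _; apply/eqP/idPn => nzX.
    have XI : X \in I by apply: rpred_sum => l _; rewrite rpredZ.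
    have [Y YJ YX] := homG_left_inverse F'G (socle_irr i) XI nzX.
    have YX0 : Y *m X = 0.
      rewrite (coord_vbasis YJ) mulmx_suml big1 // => k _.
      rewrite -scalemxAl mulmx_sumr.
      rewrite (eq_bigr (fun l => (c 0 l * Q k l)%:M)) => [|l _].
        by rewrite -raddf_sum Qc raddf0 scaler0.
      by rewrite -scalemxAr QE scale_scalar_mx.
    by case/eqP: nzX; rewrite -[X]mulmx1 -YX YX0 mulmx0.
  apply/rowP => l; rewrite [RHS]mxE.
  by have /freeP/(_ _ X0 l) := basis_free (vbasisP I).
have [P PQ] := row_fullP fullQ.
exists (fun k => \sum_j P k j *: (vbasis J)`_j) => [k|k l].
  by apply: rpred_sum => j _; rewrite rpredZ.
rewrite mulmx_suml (eq_bigr (fun j => (P k j * Q j l)%:M)) => [|j _].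
  by rewrite -raddf_sum; move/matrixP/(_ k l): PQ; rewrite !mxE => ->.
by rewrite -scalemxAl QE scale_scalar_mx.
Qed.

(** The products [iota i k *m pi i l] act as matrix units, one block of size [m i] for each
    irreducible. They are linearly independent because multiplying by [pi] on the left and [iota] on
    the right isolates one coefficient. *)
Lemma sum_sqr_dim_homG_le :
  (\sum_(i : sG) \dim (homG (irr_repr i) rG) ^ 2 <= \dim (homG rG rG))%N.
Proof.
pose m (i : sG) := \dim (homG (irr_repr i) rG).
pose iota (i : sG) (k : 'I_(m i)) := (vbasis (homG (irr_repr i) rG))`_k.
have iotaG i k : iota i k \in homG (irr_repr i) rG.
  by apply/vbasis_mem/mem_nth; rewrite size_tuple.
have /fin_all_exists2[pi piG piK] := homG_dual_basis.
pose T := {i : sG & 'I_(m i) * 'I_(m i)}%type.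
pose E (t : T) := iota (tag t) (tagged t).1 *m pi (tag t) (tagged t).2.
pose f (c : {ffun T -> F^o}) : 'M_n := \sum_t c t *: E t.
have lin_f : linear f.
  move=> a c c'; rewrite /f scaler_sumr -big_split; apply: eq_bigr => t _ /=.
  by rewrite !ffunE scalerDl scalerA.
have [fL fLE] := linear_lfun lin_f.
have fL_in c : fL c \in homG rG rG.
  rewrite fLE; apply: rpred_sum => t _; rewrite rpredZ //.
  exact: homG_comp (iotaG _ _) (piG _ _).
have extract c (i : sG) k l :
    pi i k *m fL c *m iota i l = (c (Tagged _ (k, l)))%:M.
  rewrite fLE mulmx_sumr mulmx_suml (bigD1 (Tagged _ (k, l))) //= big1 ?addr0.
    by rewrite -scalemxAr -scalemxAl /E /= !mulmxA piK eqxx mul1mx piK eqxx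
               scalemx1.
  move=> [j [k' l']] /= nt; rewrite -scalemxAr -scalemxAl /E /=.
  (* Different blocks annihilate each other, since a nonzero composite would identify the two
     irreducibles; within a block, duality of [pi] and [iota] applies. *)
  case: (eqVneq j i) => [eq_ji | nij]; last first.
    rewrite !mulmxA (_ : pi i k *m iota j k' = 0) ?mul0mx ?scaler0 //.
    apply: contra_neq_eq nij.
    exact: homG_irr_eq (homG_comp (piG i k) (iotaG j k')).
  rewrite {j}eq_ji in k' l' nt *.
  have: (k != k') || (l != l').
    rewrite -negb_and; apply: contraNN nt => /andP[/eqP-> /eqP->] //.
  rewrite !mulmxA piK -mulmxA piK (eq_sym l').
  by case/orP=> /negPf->; rewrite mulr0n raddf0 ?mul0mx ?mulmx0 scaler0.
suff ker0 : (fullv :&: lker fL)%VS = 0%VS.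
  have := limg_dim_eq ker0; rewrite dimvf /dim /= muln1 => dimf.
  rewrite (@leq_trans #|{: T}|) //.
    rewrite card_tagged sumnE big_map big_enum leq_eqVlt; apply/orP; left.
    by apply/eqP/eq_bigr => i _; rewrite card_prod card_ord mulnn.
  rewrite -dimf; apply: dimvS; apply/subvP => _ /memv_imgP[c _ ->].
  exact: fL_in.
apply/eqP; rewrite capfv -subv0; apply/subvP => c; rewrite memv_ker => /eqP c0.
rewrite memv0; apply/eqP/ffunP => -[i [k l]]; rewrite [RHS]ffunE.
have := extract c i k l; rewrite c0 mulmx0 mul0mx => /matrixP.
(* A scalar matrix determines its scalar only if it has an entry, whence the positivity of the
   degree. *)
move/(_ (Ordinal (irr_degree_gt0 i)) (Ordinal (irr_degree_gt0 i))).
by rewrite !mxE eqxx.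
Qed.

End Multiplicities.

(** The maps [f t] with [P t] are jointly injective on [U]. Imposing their kernels one at a time
    lowers the dimension by at most [\dim (L t)] at each step and ends at 0. *)
Lemma dimv_le_sum (K : fieldType) (aT : vectType K) (T : finType) (P : pred T)
    (rT : T -> vectType K) (f : forall t, 'Hom(aT, rT t))
    (L : forall t, {vspace rT t}) (U : {vspace aT}) :
  (forall t u, P t -> u \in U -> f t u \in L t) ->
  (forall u, u \in U -> (forall t, P t -> f t u = 0) -> u = 0) ->
  (\dim U <= \sum_(t | P t) \dim (L t))%N.
Proof.
move=> fL f0.
have bound r : (\dim U <= \sum_(t <- r | P t) \dim (L t)
    + \dim (U :&: \bigcap_(t <- r | P t) lker (f t)))%N.
  elim: r => [|t r IHr]; first by rewrite !big_nil capvf.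
  rewrite !big_cons; case: ifP => // Pt; apply: leq_trans IHr _.
  rewrite addnAC addnC leq_add2r addnC (capvC (lker _)) capvA.
  set W := (U :&: _)%VS; rewrite -(limg_ker_dim (f t) W) leq_add2l dimvS //.
  apply/subvP=> _ /memv_imgP[u /memv_capP[Uu _] ->]; exact: fL.
have := bound (index_enum T).
suff -> : (U :&: \bigcap_(t | P t) lker (f t))%VS = 0%VS by rewrite dimv0 addn0.
apply/eqP; rewrite -subv0; apply/subvP=> u /memv_capP[Uu /subv_bigcapP kf].
by rewrite memv0 (f0 u) // => t Pt; apply/eqP; rewrite -memv_ker; apply: kf.
Qed.

(** * The dual of a representation twisted by an anti-involution *)

Section TwistedDual.

Variables (F : closedFieldType) (gT : finGroupType) (G : {group gT}).
Variables (sigma : gT -> gT) (sigma_anti : anti_involution G sigma).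

Lemma anti_involution1 : sigma 1%g = 1%g.
Proof.
have [_ sigmaM _] := sigma_anti.
by apply: (@mulgI _ (sigma 1%g)); rewrite -sigmaM ?group1 // !mulg1.
Qed.

Lemma sdual_mx_repr n (rG : mx_representation F G n) :
  mx_repr G (fun g => (rG (sigma g))^T).
Proof.
have [sigmaG sigmaM _] := sigma_anti.
split=> [|g h Gg Gh]; first by rewrite anti_involution1 repr_mx1 trmx1.
by rewrite sigmaM // repr_mxM ?sigmaG // trmx_mul.
Qed.

(** This is the contragredient twisted by the automorphism [g |-> (sigma g)^-1]. An intertwiner into
    it is a bilinear form [B] with [B(u, g v) = B(sigma(g) u, v)]. *)
Definition sdual_repr n (rG : mx_representation F G n) :=
  MxRepresentation (sdual_mx_repr rG).

(** Transposition exchanges the two arguments of the form; equivariance survives because [sigma] is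
    an involution. *)
Lemma homG_sdual_tr n m (rG : mx_representation F G n)
    (sG : mx_representation F G m) X :
  X \in homG rG (sdual_repr sG) -> X^T \in homG sG (sdual_repr rG).
Proof.
have [sigmaG _ sigmaK] := sigma_anti.
move=> /homGP XG; apply/homGP => g Gg.
by rewrite -trmx_mul XG ?sigmaG //= trmx_mul trmxK sigmaK.
Qed.

Lemma dim_homG_sdualC n m (rG : mx_representation F G n)
    (sG : mx_representation F G m) :
  \dim (homG rG (sdual_repr sG)) = \dim (homG sG (sdual_repr rG)).
Proof.
suff le n1 n2 (r1 : mx_representation F G n1) (r2 : mx_representation F G n2) :
    (\dim (homG r1 (sdual_repr r2)) <= \dim (homG r2 (sdual_repr r1)))%N.
  by apply/eqP; rewrite eqn_leq !le.
rewrite -(@limg_dim_eq _ _ _ (linfun trmx)).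
  apply: dimvS; apply/subvP => _ /memv_imgP[X XG ->].
  by rewrite lfunE; apply: homG_sdual_tr.
apply/eqP; rewrite -subv0; apply/subvP => X /memv_capP[_].
by rewrite memv_ker lfunE /= trmx_eq0 memv0.
Qed.

Hypothesis F'G : [pchar F]^'.-group G.

(** A nonzero [X] in some [L j] is invertible, so every [Z] in [L k] factors as [X] times an
    intertwiner from the [k]-th to the [j]-th irreducible. Schur's lemma then forces [k = j] or
    [Z = 0], and makes [L j] a line. *)
Lemma sum_dim_homG_sdual (i : Irr F G) :
  (\sum_(j : Irr F G)
     \dim (homG (irr_repr j) (sdual_repr (irr_repr i))) <= 1)%N.
Proof.
pose L (j : Irr F G) := homG (irr_repr j) (sdual_repr (irr_repr i)).
have [/forallP L0 | ] := boolP [forall j, L j == 0%VS].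
  by rewrite big1 // => j _; rewrite -/(L j) (eqP (L0 j)) dimv0.
rewrite negb_forall => /existsP[j nzL].
set X := vpick (L j); have XL : X \in L j by apply: memv_pick.
have nzX : X != 0 by rewrite vpick0.
have [Y YG YX] := homG_left_inverse F'G (socle_irr j) XL nzX.
(* The transpose of [X] is again an intertwiner out of an irreducible representation, so it is
   injective and [X] has a right inverse too. *)
have XY : X *m Y = 1%:M.
  have /row_fullP[B BX] : row_full X^T.
    by apply: homG_row_full (socle_irr i) (homG_sdual_tr XL) _; rewrite trmx_eq0.
  have XB : X *m B^T = 1%:M by rewrite -[X]trmxK -trmx_mul BX trmx1.
  by rewrite -[Y]mulmx1 -XB (mulmxA Y) YX mul1mx.
have genL k Z : Z \in L k ->
    Z = X *m (Y *m Z) /\ Y *m Z \in homG (irr_repr k) (irr_repr j).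
  by move=> ZL; rewrite mulmxA XY mul1mx; split=> //; apply: homG_comp YG ZL.
rewrite (bigD1 j) //= big1 ?addn0 => [|k nkj].
  apply: (@leq_trans (\dim <[X]>)); last by rewrite dim_vline leq_b1.
  apply/dimvS/subvP => Z /genL[ZE YZ]; rewrite ZE.
  have /is_scalar_mxP[a ->] := homG_scalar (irr_repr_abs j) YZ.
  by rewrite mul_mx_scalar rpredZ ?memv_line.
apply/eqP; rewrite dimv_eq0 -subv0; apply/subvP => Z /genL[ZE YZ]; rewrite ZE.
apply/idPn => nz; case/eqP: nkj; apply: (homG_irr_eq F'G YZ).
by apply: contraNneq nz => ->; rewrite mulmx0 mem0v.
Qed.

End TwistedDual.

(** * Two estimates for sums over symmetric arrays *)

(** By symmetry, twice the upper triangle is the upper plus the lower triangle, which covers the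
    square and the diagonal once more. Here [enum_rank] serves as a total order on [T]. *)
Lemma sum_symmetric_half (T : finType) (D : T -> T -> nat) :
  (forall a b, D a b = D b a) ->
  (2 * \sum_(p : T * T | enum_rank p.1 <= enum_rank p.2) D p.1 p.2
    = \sum_a \sum_b D a b + \sum_a D a a)%N.
Proof.
move=> symD.
have -> : (\sum_(p : T * T | (enum_rank p.1 <= enum_rank p.2)%N) D p.1 p.2
    = \sum_a \sum_(b | (enum_rank a <= enum_rank b)%N) D a b)%N.
  by rewrite pair_big_dep.
set S := (X in (2 * X)%N); rewrite mul2n -addnn.
have {2}-> : S = (\sum_a \sum_(b | (enum_rank b <= enum_rank a)%N) D a b)%N.
  rewrite /S (exchange_big_dep xpredT) //=.
  by apply: eq_bigr => a _; apply: eq_bigr => b _.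
rewrite -!big_split; apply: eq_bigr => a _ /=.
rewrite addnC [in RHS](bigID (fun b => enum_rank b <= enum_rank a)%N) /=.
rewrite -addnA; congr addn; rewrite (bigD1 a) //= addnC; congr addn.
apply: eq_bigl => b; rewrite -ltnNge ltn_neqAle andbC; congr andb.
by rewrite -(inj_eq enum_rank_inj) eq_sym.
Qed.

(** From [2 m_i m_j <= m_i^2 + m_j^2]: symmetry makes the column sums of [d] at most 1 as well, so
    each square contributes at most once. *)
Lemma sum_quadratic_le (I : finType) (m : I -> nat) (d : I -> I -> nat) :
  (forall i j, d i j = d j i) -> (forall i, \sum_j d i j <= 1)%N ->
  (\sum_i \sum_j m i * m j * d i j <= \sum_i m i ^ 2)%N.
Proof.
move=> symd d1.
rewrite -(leq_pmul2l (isT : 0 < 2)%N) [leqRHS]mul2n -[leqRHS]addnn.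
have sq_le : (\sum_i \sum_j m i ^ 2 * d i j <= \sum_i m i ^ 2)%N.
  apply: leq_sum => i _.
  by rewrite -big_distrr /= -[leqRHS]muln1 leq_mul2l d1 orbT.
apply: leq_trans (leq_add sq_le sq_le).
rewrite [X in (_ <= _ + X)%N]exchange_big -big_split big_distrr.
apply: leq_sum => i _ /=.
rewrite -big_split big_distrr; apply: leq_sum => j _ /=.
by rewrite (symd j) -mulnDl mulnA leq_mul2r (nat_Cauchy _ _) orbT.
Qed.

(** * Dimension of a space of equivariant symmetric forms *)

Section SymmetricForms.

Variables (F : closedFieldType) (gT : finGroupType) (G : {group gT}).
Hypothesis F'G : [pchar F]^'.-group G.
Variables (sigma : gT -> gT) (sigma_anti : anti_involution G sigma).
Variables (n : nat) (rG : mx_representation F G n).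

Lemma dim_symmetric_forms_le (U : {vspace 'M[F]_n}) :
  (U <= homG rG (sdual_repr sigma_anti rG))%VS ->
  (forall Y, Y \in U -> Y^T = Y) ->
  (2 * \dim U <= \sum_(i : Irr F G) \dim (homG (irr_repr i) rG) ^ 2
                 + \sum_(i : Irr F G) \dim (homG (irr_repr i) rG))%N.
Proof.
move=> /subvP UG symU.
pose m (i : Irr F G) := \dim (homG (irr_repr i) rG).
pose T := {i : Irr F G & 'I_(m i)}.
pose iota (a : T) := (vbasis (homG (irr_repr (tag a)) rG))`_(tagged a).
have iotaG a : iota a \in homG (irr_repr (tag a)) rG.
  by apply/vbasis_mem/mem_nth; rewrite size_tuple.
(* Basis embeddings already separate vectors: together, their images span the whole
   representation. *)
have iota_sep k (v : 'M_(k, n)) : (forall a, v *m iota a = 0) -> v = 0.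
  move=> v0; apply: (homG_irr_separate F'G (rG := rG)) => i X XG.
  rewrite (coord_vbasis XG) mulmx_sumr big1 // => l _.
  by rewrite -scalemxAr (v0 (Tagged (fun i => 'I_(m i)) l)) scaler0.
pose L (p : T * T) := homG (irr_repr (tag p.2))
                           (sdual_repr sigma_anti (irr_repr (tag p.1))).
pose d (i j : Irr F G) :=
  \dim (homG (irr_repr j) (sdual_repr sigma_anti (irr_repr i))).
have symd i j : d i j = d j i by apply: dim_homG_sdualC.
have sum_d i : (\sum_j d i j <= 1)%N by apply: sum_dim_homG_sdual.
have lin_f (p : T * T) : linear (fun Y : 'M_n => (iota p.1)^T *m Y *m iota p.2).
  by move=> a Y Y'; rewrite mulmxDr mulmxDl -scalemxAr -scalemxAl.
have /fin_all_exists[f fE] p := linear_lfun (lin_f p).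
have bound : (\dim U <= \sum_(p : T * T | (enum_rank p.1 <= enum_rank p.2)%N)
    d (tag p.1) (tag p.2))%N.
  apply: (dimv_le_sum (f := f) (L := L)) => [p Y _ YU | Y YU Y0].
    rewrite fE /=; apply/homGP => g Gg; have [sigmaG _ _] := sigma_anti.
    rewrite -(mulmxA _ (iota p.2)) (homGP _ _ _ (iotaG p.2)) //.
    rewrite mulmxA -(mulmxA _ Y).
    rewrite (homGP _ _ _ (UG _ YU)) // !mulmxA /= -!trmx_mul.
    by rewrite -(homGP _ _ _ (iotaG p.1)) // sigmaG.
  (* For a pair in the wrong order, transpose and use the symmetry of [Y]. *)
  have Y0' a b : (iota a)^T *m Y *m iota b = 0.
    have [le_ab | /ltnW le_ba] := leqP (enum_rank a) (enum_rank b).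
      by rewrite -(Y0 (a, b)) ?fE.
    apply: trmx_inj; rewrite trmx0 !trmx_mul trmxK symU // mulmxA.
    by rewrite -(Y0 (b, a)) ?fE.
  apply: (iota_sep) => a; apply: trmx_inj; rewrite trmx_mul symU // trmx0.
  by apply: (iota_sep) => b; apply: Y0'.
apply: leq_trans (leq_mul (leqnn 2) bound) _.
(* The square is [\sum_i \sum_j m i * m j * d i j], bounded by the sum of squares; the diagonal is
   [\sum_i m i * d i i], where each [d i i] is at most 1. *)
rewrite (sum_symmetric_half (D := fun a b : T => d (tag a) (tag b))) //.
have sumT (f1 : Irr F G -> nat) :
    (\sum_(a : T) f1 (tag a) = \sum_i m i * f1 i)%N.
  transitivity (\sum_i \sum_(k < m i) f1 i)%N; first by rewrite sig_big_dep.
  by apply: eq_bigr => i _; rewrite sum_nat_const card_ord.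
apply: leq_add.
  rewrite (sumT (fun i => \sum_(b : T) d i (tag b))%N).
  apply: leq_trans (sum_quadratic_le m symd sum_d).
  apply: leq_sum => i _; rewrite (sumT (d i)) big_distrr.
  by apply: leq_sum => j _ /=; rewrite mulnA.
rewrite (sumT (fun i => d i i)); apply: leq_sum => i _.
rewrite -[leqRHS]muln1 leq_mul2l (leq_trans _ (sum_d i)) ?orbT //.
by rewrite (bigD1 i) //= leq_addr.
Qed.

End SymmetricForms.

(** * Permutation matrices on cosets, and double cosets *)

Section CosetMatrices.

Variables (F : fieldType) (gT : finGroupType) (G H : {group gT}).
Hypothesis sHG : H \subset G.
Let V := lcosets_repr F G H.

Lemma group_in_lcosets : (H : {set gT}) \in lcosets H G.
Proof. by apply/imsetP; exists 1%g; rewrite ?group1 // lcosetE lcoset1. Qed.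

(** Meaningful for [x] in [G]; elsewhere [enum_rank_in] returns a default index. *)
Definition lcoset_index (x : gT) : 'I_#|lcosets H G| :=
  enum_rank_in group_in_lcosets (x *: H)%g.

Definition lcoset_repr (i : 'I_#|lcosets H G|) : gT := repr (enum_val i).

Lemma lcoset_indexK x : x \in G -> enum_val (lcoset_index x) = (x *: H)%g.
Proof.
move=> Gx; rewrite enum_rankK_in //; apply/imsetP.
by exists x; rewrite // lcosetE.
Qed.

Lemma lcoset_indexMr x h : h \in H -> lcoset_index (x * h)%g = lcoset_index x.
Proof. by move=> Hh; rewrite /lcoset_index lcosetM lcoset_id. Qed.

Lemma lcoset_repr_in i : lcoset_repr i \in G.
Proof.
rewrite /lcoset_repr; have /imsetP[x Gx ->] := enum_valP i.
rewrite lcosetE; have /lcosetP[h Hh ->] := mem_repr _ (lcoset_refl H x).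
by rewrite groupM // (subsetP sHG).
Qed.

Lemma lcoset_reprK i : lcoset_index (lcoset_repr i) = i.
Proof.
apply: enum_val_inj; rewrite lcoset_indexK ?lcoset_repr_in //.
rewrite /lcoset_repr; have /imsetP[x Gx ->] := enum_valP i; rewrite lcosetE.
by apply/lcoset_eqP; apply: (mem_repr x); apply: lcoset_refl.
Qed.

Lemma lcoset_index_repr x : x \in G ->
  exists2 h, h \in H & lcoset_repr (lcoset_index x) = (x * h)%g.
Proof.
move=> Gx; rewrite /lcoset_repr lcoset_indexK //.
by have /lcosetP[h Hh ->] := mem_repr _ (lcoset_refl H x); exists h.
Qed.

Lemma mul_lcosets_mxr m (Y : 'M_(m, #|lcosets H G|)) g i x :
  g \in G -> x \in G ->
  (Y *m V g) i (lcoset_index x) = Y i (lcoset_index (g * x)%g).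
Proof.
move=> Gg Gx; rewrite mxE (bigD1 (lcoset_index (g * x)%g)) //= big1 => [|k nk].
  by rewrite mxE !lcoset_indexK ?groupM // lcosetM eqxx mulr1 addr0.
rewrite mxE lcoset_indexK // -lcosetM -lcoset_indexK ?groupM //.
by rewrite (inj_eq enum_val_inj) (negPf nk) mulr0.
Qed.

Lemma mul_lcosets_mxl m (Y : 'M_(#|lcosets H G|, m)) g x j :
  g \in G -> x \in G ->
  (V g *m Y) (lcoset_index x) j = Y (lcoset_index (g^-1 * x)%g) j.
Proof.
move=> Gg Gx; have GVg := groupVr Gg.
rewrite mxE (bigD1 (lcoset_index (g^-1 * x)%g)) //= big1 => [|k nk].
  by rewrite mxE !lcoset_indexK ?groupM // -lcosetM mulKVg eqxx mul1r addr0.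
rewrite mxE lcoset_indexK // -{1}(mulKVg g x) lcosetM.
rewrite (inj_eq (@lcoset_inj _ g)).
rewrite -lcoset_indexK ?groupM // (inj_eq enum_val_inj) eq_sym (negPf nk).
by rewrite mul0r.
Qed.

Lemma dcoset_in_dcosets g : g \in G -> (H :* g * H)%g \in dcosets G H.
Proof. by move=> Gg; apply: imset_f. Qed.

Lemma mem_dcoset_refl g : g \in (H :* g * H)%g.
Proof. by rewrite -{1}[g]mulg1 mem_mulg ?rcoset_refl. Qed.

Lemma dcosetMl h g : h \in H -> (H :* (h * g) * H = H :* g * H)%g.
Proof. by move=> Hh; rewrite rcosetM rcoset_id. Qed.

Lemma dcosetMr h g : h \in H -> (H :* (g * h) * H = H :* g * H)%g.
Proof. by move=> Hh; rewrite -mulgA lcosetM lcoset_id // mulgA. Qed.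

(** By equivariance, an endomorphism is determined by its column at the coset [H], and that column
    is constant on double cosets. Sampling it at one representative per double coset is therefore
    injective. *)
Lemma dim_homG_lcosets_le : (\dim (homG V V) <= \dim {: dcoset_space F G H})%N.
Proof.
pose f (X : 'M_#|lcosets H G|) : dcoset_space F G H :=
  [ffun D => X (lcoset_index (repr (val D))) (lcoset_index 1%g)].
have lin_f : linear f.
  by move=> a X Y; apply/ffunP => D; rewrite !ffunE !mxE.
have [fL fE] := linear_lfun (K := F) lin_f.
have -> : \dim (homG V V) = \dim (fL @: homG V V); last by rewrite dimvS ?subvf.
apply/esym/limg_dim_eq.
apply/eqP; rewrite -subv0; apply/subvP => X /memv_capP[/homGP XG].
rewrite memv_ker memv0 fE => /eqP X0; apply/eqP/matrixP => i j; rewrite [RHS]mxE.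
have shift g x y : g \in G -> x \in G -> y \in G ->
    X (lcoset_index x) (lcoset_index (g * y)) =
    X (lcoset_index (g^-1 * x)) (lcoset_index y).
  by move=> Gg Gx Gy; rewrite -mul_lcosets_mxr // -mul_lcosets_mxl // XG.
rewrite -(lcoset_reprK i) -(lcoset_reprK j).
set x := lcoset_repr i; set y := lcoset_repr j.
have [Gx Gy] : x \in G /\ y \in G by rewrite !lcoset_repr_in.
have Gz : (y^-1 * x)%g \in G by rewrite groupM ?groupV.
rewrite -{1}[y]mulg1 shift //; set z := (y^-1 * x)%g in Gz *.
pose D := exist (fun D => D \in dcosets G H) _ (dcoset_in_dcosets Gz).
have /ffunP/(_ D) := X0; rewrite !ffunE /=.
have /mulsgP[_ k /rcosetP[h Hh ->] Hk ->] := mem_repr _ (mem_dcoset_refl z).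
(* The chosen representative of the double coset of [z] is [h * z * k]: the row coset absorbs [k],
   while [shift] carries [h] to the column at [H], which absorbs it. *)
rewrite lcoset_indexMr // => <-.
have Gh := subsetP sHG _ Hh.
have := shift h^-1%g z 1%g (groupVr Gh) Gz (group1 G); rewrite invgK => <-.
by rewrite mulg1 -[in RHS](mul1g h^-1%g) (lcoset_indexMr 1%g) ?groupV.
Qed.

End CosetMatrices.

(** * The induced involution on double cosets and its fixed vectors *)

Section InducedInvolution.

Variables (F : closedFieldType) (gT : finGroupType) (G H : {group gT}).
Hypothesis sHG : H \subset G.
Variables (sigma : gT -> gT) (sigma_anti : anti_involution G sigma).
Variable sigmaZ : 'End(dcoset_space F G H).
Hypothesis sigmaZ_induced : {in G, forall g,
  sigmaZ (dcoset_vec F G H g) = dcoset_vec F G H (sigma g)}.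

(** Reads [f] as an [(H,H)]-invariant function of [g], extended by 0 to double cosets outside
    [dcosets G H]. *)
Definition dcoset_eval (f : dcoset_space F G H) (g : gT) : F :=
  oapp f 0 (insub (H :* g * H)%g).

Lemma dcoset_eval_linear g : linear (dcoset_eval^~ g : _ -> F^o).
Proof.
move=> a f f'; rewrite /dcoset_eval; case: insub => [D|] /=.
  by rewrite !ffunE.
by rewrite scaler0 addr0.
Qed.

Lemma dcoset_evalE f g (Gg : g \in G) :
  dcoset_eval f g
    = f (exist (fun D => D \in dcosets G H) _ (dcoset_in_dcosets H Gg)).
Proof.
rewrite /dcoset_eval insubT ?dcoset_in_dcosets // => D0 /=.
by congr (f _); apply: val_inj.
Qed.

Lemma dcoset_eval_vec x g : g \in G ->
  dcoset_eval (dcoset_vec F G H x) g = ((H :* g * H == H :* x * H)%g)%:R.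
Proof. by move=> Gg; rewrite dcoset_evalE ffunE. Qed.

Lemma dcoset_vec_inj x y : x \in G ->
  dcoset_vec F G H x = dcoset_vec F G H y -> (H :* x * H = H :* y * H)%g.
Proof.
move=> Gx /(congr1 (dcoset_eval^~ x)); rewrite !dcoset_eval_vec // eqxx.
by case: eqP => // _ /eqP; rewrite oner_eq0.
Qed.

(** Equal double cosets have equal basis vectors, hence equal images under [sigmaZ], and a basis
    vector determines its double coset. *)
Lemma dcoset_sigma x y : x \in G -> y \in G ->
  (H :* x * H = H :* y * H)%g -> (H :* sigma x * H = H :* sigma y * H)%g.
Proof.
have [sigmaG _ _] := sigma_anti; move=> Gx Gy eq_xy.
apply: dcoset_vec_inj; rewrite ?sigmaG // -!sigmaZ_induced //.
by congr (sigmaZ _); apply/ffunP => D; rewrite !ffunE eq_xy.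
Qed.

(** Compare the trivial double coset with that of [h]: [sigma h] lies in the double coset of
    [sigma 1 = 1], which is [H]. *)
Lemma sigma_in_subgroup h : h \in H -> sigma h \in H.
Proof.
move=> Hh; have Gh := subsetP sHG _ Hh.
have := dcoset_sigma Gh (group1 G).
rewrite (anti_involution1 sigma_anti) -{1}[h]mulg1 dcosetMl //.
move=> /(_ erefl) eq_s.
have := mem_dcoset_refl H (sigma h).
by rewrite eq_s mulg1 mulGid.
Qed.

Lemma dcoset_space_decomp (f : dcoset_space F G H) :
  f = \sum_D f D *: dcoset_vec F G H (repr (val D)).
Proof.
have reprD (D : {D : {set gT} | D \in dcosets G H}) :
    (H :* repr (val D) * H)%g = val D.
  have /imsetP[x Gx DE] := valP D; rewrite DE.
  have /mulsgP[_ k /rcosetP[h Hh ->] Hk ->] := mem_repr _ (mem_dcoset_refl H x).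
  by rewrite dcosetMr // dcosetMl.
apply/ffunP => D; rewrite sum_ffunE (bigD1 D) //= big1 => [|D' nD].
  by rewrite !ffunE reprD eqxx addr0 /= [_ *: _]mulr1.
by rewrite !ffunE reprD (inj_eq val_inj) eq_sym (negPf nD) scaler0.
Qed.

(** By linearity it suffices to treat basis vectors. There the claim is that [sigma] preserves and
    reflects equality of double cosets, the reflection coming from [sigma] being an involution. *)
Lemma dcoset_eval_sigma f g : g \in G ->
  dcoset_eval (sigmaZ f) (sigma g) = dcoset_eval f g.
Proof.
have [sigmaG _ sigmaK] := sigma_anti.
move=> Gg; have [e1 e1E] := linear_lfun (K := F) (dcoset_eval_linear g).
have [e2 e2E] := linear_lfun (K := F) (dcoset_eval_linear (sigma g)).
rewrite -[LHS]e2E -[RHS]e1E {}[f]dcoset_space_decomp !linear_sum.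
apply: eq_bigr => D _; rewrite !linearZ /=.
set x := repr (val D).
suff -> : e2 (sigmaZ (dcoset_vec F G H x)) = e1 (dcoset_vec F G H x) by [].
have Gx : x \in G.
  rewrite /x; have /imsetP[y Gy ->] := valP D.
  have /mulsgP[_ k /rcosetP[h Hh ->] Hk ->] := mem_repr _ (mem_dcoset_refl H y).
  by rewrite !groupM // (subsetP sHG).
rewrite sigmaZ_induced // e1E e2E !dcoset_eval_vec ?sigmaG //.
congr (_%:R); congr nat_of_bool; apply/eqP/eqP; last by apply: dcoset_sigma.
by move/dcoset_sigma; rewrite !sigmaK ?sigmaG // => ->; rewrite ?sigmaG.
Qed.

Lemma dim_fixedSpace_le : [pchar F]^'.-group G ->
  (2 * \dim (fixedSpace sigmaZ)
   <= \sum_(i : Irr F G) \dim (homG (irr_repr i) (lcosets_repr F G H)) ^ 2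
      + \sum_(i : Irr F G) \dim (homG (irr_repr i) (lcosets_repr F G H)))%N.
Proof.
move=> F'G; have [sigmaG sigmaM sigmaK] := sigma_anti.
pose Y (f : dcoset_space F G H) : 'M[F]_#|lcosets H G| :=
  \matrix_(i, j) dcoset_eval f (sigma (lcoset_repr j) * lcoset_repr i)%g.
have lin_Y : linear Y.
  move=> a f f'; apply/matrixP => i j; rewrite !mxE.
  exact: dcoset_eval_linear.
have [YL YE] := linear_lfun (K := F) lin_Y.
(* The form does not depend on coset representatives: changing [y] by [k] in [H] multiplies by
   [sigma k] on the left, which is again in [H]. *)
have Y_index f x y : x \in G -> y \in G ->
    YL f (lcoset_index G H x) (lcoset_index G H y)
      = dcoset_eval f (sigma y * x)%g.
  move=> Gx Gy; rewrite YE mxE.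
  have [h Hh ->] := lcoset_index_repr H Gx.
  have [k Hk ->] := lcoset_index_repr H Gy.
  rewrite sigmaM ?(subsetP sHG k) // /dcoset_eval.
  rewrite (mulgA _ x) dcosetMr // -(mulgA (sigma k)).
  by rewrite dcosetMl // sigma_in_subgroup.
(* The map from [f] to its form is injective, because the column at [H] lists the values of [f]. *)
have -> : \dim (fixedSpace sigmaZ) = \dim (YL @: fixedSpace sigmaZ).
  apply/esym/limg_dim_eq/eqP; rewrite -subv0; apply/subvP => f /memv_capP[_].
  rewrite memv_ker memv0 => /eqP Y0; apply/eqP/ffunP => -[D DZ].
  have /imsetP[x Gx DE] := DZ.
  have := Y_index f x 1%g Gx (group1 G).
  rewrite Y0 mxE (anti_involution1 sigma_anti) mul1g (dcoset_evalE _ Gx).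
  rewrite ffunE => ->.
  by congr (f _); apply: val_inj.
apply: (dim_symmetric_forms_le F'G (sigma_anti := sigma_anti)).
  (* Equivariance amounts to [sigma(g y) x = sigma(y) (sigma(g) x)]. *)
  apply/subvP => _ /memv_imgP[f _ ->]; apply/homGP => g Gg.
  apply/matrixP => i j.
  rewrite -(lcoset_reprK sHG i) -(lcoset_reprK sHG j).
  have [Gx Gy] := (lcoset_repr_in sHG i, lcoset_repr_in sHG j).
  rewrite mul_lcosets_mxr // Y_index ?groupM // sigmaM //.
  have trE (A : 'M[F]_#|lcosets H G|) k l : A k l = A^T l k by rewrite mxE.
  rewrite [RHS]trE trmx_mul trmxK mul_lcosets_mxr ?sigmaG //.
  by rewrite [RHS]mxE Y_index ?groupM ?sigmaG // mulgA.
(* Symmetry follows from [sigmaZ f = f] and [sigma(sigma(y) x) = sigma(x) y]. *)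
move=> _ /memv_imgP[f /fixedSpaceP ff ->]; apply/matrixP => i j; rewrite mxE.
rewrite -(lcoset_reprK sHG i) -(lcoset_reprK sHG j).
have [Gx Gy] := (lcoset_repr_in sHG i, lcoset_repr_in sHG j).
rewrite !Y_index // -[in LHS]ff.
set x := lcoset_repr i in Gx *; set y := lcoset_repr j in Gy *.
rewrite (_ : (sigma x * y)%g = sigma (sigma y * x)%g).
  by rewrite dcoset_eval_sigma // groupM ?sigmaG.
by rewrite sigmaM ?sigmaK ?sigmaG.
Qed.

End InducedInvolution.

(** * From the dimension bounds to the ratio *)

Lemma pgroup_pchar_num (F : numFieldType) (gT : finGroupType) (G : {group gT}) :
  [pchar F]^'.-group G.
Proof. by rewrite /pgroup pcharf'_nat pnatr_eq0 -lt0n cardG_gt0. Qed.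

Theorem theorem1p2p7 (R : realType) (gT : finGroupType) (G H : {group gT})
    (sHG : H \subset G) (eps : R)
    (sigma : gT -> gT) (sigma_anti : anti_involution G sigma)
    (sigmaZ : 'End(dcoset_space R[i] G H))
    (sigmaZ_induced : {in G, forall g,
       sigmaZ (dcoset_vec R[i] G H g) = dcoset_vec R[i] G H (sigma g)})
    (codim_le : (\dim {: dcoset_space R[i] G H})%:R - (\dim (fixedSpace sigmaZ))%:R
                <= eps * (\dim {: dcoset_space R[i] G H})%:R) :
  (#|[set i : Irr R[i] G |
        \dim (homG (irr_repr i) (lcosets_repr R[i] G H)) == 1%N]|%:R
   / #|[set i : Irr R[i] G |
        (0 < \dim (homG (irr_repr i) (lcosets_repr R[i] G H)))%N]|%:R)
  >= 1 - 4 * eps.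
Proof.
have R'G := pgroup_pchar_num R[i] G.
have fix_le := dim_fixedSpace_le sHG sigma_anti sigmaZ_induced R'G.
have D_ge := leq_trans (sum_sqr_dim_homG_le R'G (lcosets_repr R[i] G H))
  (dim_homG_lcosets_le R[i] sHG).
have D_gt0 : (0 < \dim {: dcoset_space R[i] G H})%N.
  rewrite dimvf /dim /= muln1; apply/card_gt0P.
  pose D1 := dcoset_in_dcosets H (group1 G).
  by exists (exist (fun D => D \in dcosets G H) _ D1).
move: fix_le D_ge D_gt0 codim_le.
set D := \dim {: _}; set f := \dim (fixedSpace _).
pose m (i : Irr R[i] G) := \dim (homG (irr_repr i) (lcosets_repr R[i] G H)).
set S := (\sum_i m i ^ 2)%N; set M := (\sum_i m i)%N.
move=> fix_le D_ge D_gt0 codim_le.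
set n1 := #|_|; set n0 := #|_|.
have n1E : n1 = (\sum_i (m i == 1%N))%N by rewrite /n1 -sum1dep_card big_mkcond.
have n0E : n0 = (\sum_i (0 < m i))%N by rewrite /n0 -sum1dep_card big_mkcond.
have n0_le : (n0 <= S)%N.
  by rewrite n0E; apply: leq_sum => i _; case: (m i) => // k; rewrite expn_gt0.
(* Termwise, [2 m <= m^2] for every [m] other than 1, and [m = 1] falls short by exactly 1. *)
have M_le : (2 * M <= S + n1)%N.
  rewrite n1E -big_split big_distrr; apply: leq_sum => i _ /=.
  by case: (m i) => [|[|k]] //; rewrite /= addn0 expnS leq_mul2r.
(* For [eps >= 1/4] the lower bound is nonpositive. Otherwise [1 - eps] and [1 - 4 * eps] are
   positive and may multiply inequalities. *)
have [eps_ge | eps_lt] := lerP (1 / 4) eps.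
  by apply: (@le_trans _ _ 0); [lra | rewrite divr_ge0 ?ler0n].
have f_le : 2 * f%:R <= S%:R + M%:R :> R by rewrite -natrM -natrD ler_nat.
have S_le : (1 - eps) * S%:R <= (1 - eps) * D%:R.
  by rewrite ler_wpM2l ?ler_nat //; lra.
have M_leR : 2 * M%:R <= S%:R + n1%:R :> R by rewrite -natrM -natrD ler_nat.
(* Chain the estimates: [4 (1 - eps) S <= 4 (1 - eps) D <= 4 f <= 2 S + 2 M <= 3 S + n1]. *)
have key : (1 - 4 * eps) * S%:R <= n1%:R by lra.
(* If all multiplicities vanished, then [f] would be 0, against [0 < (1 - eps) D <= f]. *)
have n0_gt0 : (0 < n0)%N.
  rewrite lt0n; apply/eqP => n0_0.
  have m0 i : m i = 0%N.
    apply/eqP; rewrite -leqn0 leqNgt; apply/negP => mi.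
    by move: n0_0; rewrite n0E (bigD1 i) //= mi.
  have S0 : S = 0%N by rewrite /S big1 // => i _; rewrite m0.
  have M0 : M = 0%N by rewrite /M big1.
  have D_gt0R : 0 < (1 - eps) * D%:R by rewrite mulr_gt0 ?ltr0n //; lra.
  by rewrite S0 M0 in f_le; lra.
rewrite ler_pdivlMr ?ltr0n //; apply: le_trans key.
by rewrite ler_wpM2l ?ler_nat //; lra.
Qed.
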